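(* Let $r,k\in\mathbb{Z}_{>0}$ with $r\geq2$ and let $R(z)\in\mathbb{C}[z]\setminus\{0\}$. Set $$P(z)=z^r R(z^k)\quad\text{and}\quad Q(z)=z^r R(z)^k.$$ Assume that $\gcd(r(r^M-1),k)=1$ for some $M\in\mathbb{Z}_{>0}$. Then there exist integers $d>c_1>0$ such that for every $N\in\mathbb{Z}_{\geq0}$, $$S_{c_1+Nd}(P)=S_{c_1+Nd}(Q).$$
   Context: For a rational map $f\in\mathbb{C}(z)$ of degree $m\ge2$ and $n\ge1$, the $n$-th iterate $f^{\circ n}$ has $m^n+1$ fixed points in $\mathbb{P}^1(\mathbb{C})$ counted with multiplicity. The multiplier of $f^{\circ n}$ at a fixed point is the differential of $f^{\circ n}$ there. $S_n(f)\in\mathbb{C}^{m^n+1}$ is the tuple of the elementary symmetric polynomials (of degrees $1,\dots,m^n+1$) in the multipliers of $f^{\circ n}$ at these fixed points (with multiplicity); equivalently, $S_n(f)$ records the multiset of these multipliers. In the formulas for $P$ and $Q$, $R(z)^k$ denotes the ordinary (multiplicative) power. *)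

(* Defs.v *)
From HB Require Import structures.
From mathcomp Require Import all_boot all_order all_algebra.
From mathcomp Require Import reals complex mpoly.

Set Implicit Arguments.
Unset Strict Implicit.
Unset Printing Implicit Defensive.
Import Order.TTheory GRing.Theory Num.Theory.
Local Open Scope ring_scope.

(* A rational map is given by a fraction in lowest terms.  The representation
   is unique up to a common nonzero scalar, on which nothing below depends. *)
Record ratmap (F : closedFieldType) := Ratmap {
  rnum : {poly F};
  rden : {poly F};
  rcoprime : coprimep rnum rden }.

Definition rdeg (F : closedFieldType) (f : ratmap F) : nat :=
  (maxn (size (rnum f)) (size (rden f))).-1.

(* b ^ d * p(a / b), for p of degree at most d. *)
Definition homog_comp (F : closedFieldType) (d : nat) (p a b : {poly F}) :
    {poly F} :=
  \sum_(i < d.+1) p`_i *: (a ^+ i * b ^+ (d - i)).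

Lemma homog_compE (F : closedFieldType) (d : nat) (p a b : {poly F}) (x : F) :
  (size p <= d.+1)%N -> b.[x] != 0 ->
  (homog_comp d p a b).[x] = b.[x] ^+ d * p.[a.[x] / b.[x]].
Proof.
move=> sp b0; rewrite (horner_coef_wide _ sp) horner_sum mulr_sumr.
apply: eq_bigr => -[i /= id] _.
have {}id : (i <= d)%N := id.
rewrite hornerZ hornerM !horner_exp [RHS]mulrCA; congr (_ * _).
rewrite expr_div_n -[X in b.[x] ^+ X * _](subnK id) exprD [RHS]mulrC -!mulrA.
congr (_ * _); rewrite mulrC -mulrA divff ?mulr1 //.
exact: expf_neq0.
Qed.

Lemma homog_comp_pole (F : closedFieldType) (d : nat) (p a b : {poly F})
    (x : F) :
  b.[x] = 0 -> (homog_comp d p a b).[x] = p`_d * a.[x] ^+ d.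
Proof.
move=> b0; rewrite horner_sum big_ord_recr /= big1 ?add0r.
  by rewrite subnn expr0 mulr1 hornerZ horner_exp.
move=> -[i /= id] _.
by rewrite hornerZ hornerM !horner_exp b0 expr0n subn_eq0 leqNgt id /= !mulr0.
Qed.

Lemma coprimep_no_root (F : closedFieldType) (p q : {poly F}) :
  (forall x, p.[x] = 0 -> q.[x] = 0 -> False) -> coprimep p q.
Proof.
move=> pq; rewrite coprimep_def; apply/negPn/negP => /closed_rootP[x].
by rewrite root_gcd => /andP[/rootP px /rootP qx]; apply: (pq x).
Qed.

Lemma rcomp_subproof (F : closedFieldType) (f g : ratmap F) :
  coprimep (homog_comp (rdeg f) (rnum f) (rnum g) (rden g))
           (homog_comp (rdeg f) (rden f) (rnum g) (rden g)).
Proof.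
case: f => p q cpq; case: g => a b cab; rewrite /rdeg /=.
set d := (maxn _ _).-1.
have mx0 : (0 < maxn (size p) (size q))%N.
  rewrite leq_max !size_poly_gt0 -negb_and.
  apply: contraTN cpq => /andP[/eqP-> /eqP->].
  by rewrite coprime0p -size_poly_eq1 size_poly0.
have sd : maxn (size p) (size q) = d.+1 by rewrite (prednK mx0).
have sp : (size p <= d.+1)%N by rewrite -sd leq_maxl.
have sq : (size q <= d.+1)%N by rewrite -sd leq_maxr.
apply: coprimep_no_root => x; have [b0|b0] := eqVneq b.[x] 0.
  rewrite !homog_comp_pole // => /eqP.
  have a0 : a.[x] != 0.
    rewrite coprimep_sym in cab; apply: coprimep_root cab _; exact/rootP.
  rewrite mulf_eq0 (negPf (expf_neq0 _ a0)) orbF => /eqP pd /eqP.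
  rewrite mulf_eq0 (negPf (expf_neq0 _ a0)) orbF => /eqP qd.
  move: sd; rewrite /maxn; case: ifP => _ s.
    have := lead_coef_eq0 q; rewrite lead_coefE s /= qd eqxx => /esym/eqP q0.
    by rewrite q0 size_poly0 in s.
  have := lead_coef_eq0 p; rewrite lead_coefE s /= pd eqxx => /esym/eqP p0.
  by rewrite p0 size_poly0 in s.
rewrite !homog_compE // => /eqP; rewrite mulf_eq0 (negPf (expf_neq0 _ b0)) /=.
move=> pr /eqP; rewrite mulf_eq0 (negPf (expf_neq0 _ b0)) /= => qr.
by have := coprimep_root cpq pr; rewrite qr.
Qed.

Definition rcomp (F : closedFieldType) (f g : ratmap F) : ratmap F :=
  Ratmap (rcomp_subproof f g).

Definition rpoly (F : closedFieldType) (p : {poly F}) : ratmap F :=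
  Ratmap (coprimep1 p).

Definition riter (F : closedFieldType) (n : nat) (f : ratmap F) : ratmap F :=
  iter n (rcomp f) (rpoly 'X).

(* z |-> 1 / z *)
Definition rinv (F : closedFieldType) : ratmap F := Ratmap (coprime1p 'X).

(* w |-> 1 / f(1 / w), i.e., f in the coordinate w = 1 / z at infinity. *)
Definition rchart (F : closedFieldType) (f : ratmap F) : ratmap F :=
  rcomp (rinv F) (rcomp f (rinv F)).

(* The numerator of f(z) - z: its order of vanishing at a finite point is the
   multiplicity of this point as a fixed point of f. *)
Definition fixpoly (F : closedFieldType) (f : ratmap F) : {poly F} :=
  rnum f - 'X * rden f.

(* The roots of a polynomial (nonzero), repeated with multiplicity. *)
Definition proots (F : closedFieldType) (p : {poly F}) : seq F :=
  sval (closed_field_poly_normal p).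

(* The fixed points of f in P^1(F) = option F, where None is the point at
   infinity, repeated with multiplicity; f must not be the identity. *)
Definition fixed_points (F : closedFieldType) (f : ratmap F) :
    seq (option F) :=
  map Some (proots (fixpoly f)) ++ nseq (mup 0 (fixpoly (rchart f))) None.

Definition rderiv (F : closedFieldType) (f : ratmap F) (x : F) : F :=
  ((rnum f)^`().[x] * (rden f).[x] - (rnum f).[x] * (rden f)^`().[x])
    / (rden f).[x] ^+ 2.

(* The differential of f at a fixed point. *)
Definition multiplier (F : closedFieldType) (f : ratmap F) (z : option F) : F :=
  if z is Some x then rderiv f x else rderiv (rchart f) 0.

Definition multipliers (F : closedFieldType) (f : ratmap F) : seq F :=
  [seq multiplier f z | z <- fixed_points f].

Definition esym (F : closedFieldType) (s : seq F) (j : nat) : F :=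
  (mesym (size s) F j).@[tnth (in_tuple s)].

Definition S_ (F : closedFieldType) (n : nat) (f : ratmap F) :
    ((rdeg f ^ n).+1).-tuple F :=
  [tuple esym (multipliers (riter n f)) i.+1 | i < (rdeg f ^ n).+1].

(* Main.v *)
(** The map [z |-> z^k] semiconjugates [P] to [Q], and the iterates keep the same
    shape: the [n]-th ones are [z^m A(z^k)] and [z^m A(z)^k] with [m = r^n].  Write
    [f = z^(m-1) A(z^k) - 1] and [g = z^(m-1) A(z)^k - 1], so that the fixed
    point equations are [z f = 0] and [z g = 0].  If [m - 1] is coprime to [k],
    then [w |-> w^(m-1)] permutes the [k]-th roots of unity, so the product of
    the [f(w z)] over these [w] is a constant times [g(z^k)]; hence the roots of
    [g] are the [k]-th powers of those of [f], with multiplicity.  At a nonzero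
    fixed point the chain rule for [P(z)^k = Q(z^k)] equates the multipliers; at 0
    and infinity they vanish.  By Euler, [r^n] modulo [k] depends only on [n]
    modulo [totient k], so [n = M + N (M+1) totient k] are all admissible. *)

Require Import Defs.
From mathcomp Require Import all_boot all_order all_algebra.
From mathcomp Require Import cyclic separable cyclotomic.
From mathcomp Require Import reals complex mpoly.
Import GRing.Theory Num.Theory.

Local Open Scope ring_scope.

(** * Symmetric functions and multisets of roots *)

(** Up to the sign [(-1) ^+ j], these are coefficients of the product of the ['X - x%:P], which
    ignores the order. *)
Lemma esym_perm (F : closedFieldType) (s t : seq F) (j : nat) :
  perm_eq s t -> Defs.esym s j = Defs.esym t j.
Proof.
move=> st; have es := perm_size st.
have [lt_sj|le_js] := ltnP (size s) j.
  by rewrite /Defs.esym !mesym_geqnE ?meval0 // -es.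
have js : (j < (size s).+1)%N by [].
have jt : (j < (size t).+1)%N by rewrite -es.
have Es := mroots_coeff (in_tuple s) (Ordinal js).
have Et := mroots_coeff (in_tuple t) (Ordinal jt).
rewrite /= in Es Et.
apply: (@mulfI _ ((-1) ^+ j)); first by rewrite signr_eq0.
by rewrite /Defs.esym -Es -Et es (perm_big _ st).
Qed.

Lemma proots_prod (F : closedFieldType) (p : {poly F}) (c : F) (s : seq F) :
  c != 0 -> p = c *: \prod_(x <- s) ('X - x%:P) -> perm_eq (proots p) s.
Proof.
move=> c0 ps; rewrite /proots; case: closed_field_poly_normal => t /= pt.
apply: prod_XsubC_eq; have lc : lead_coef p = c.
  by rewrite ps lead_coefZ (monicP (monic_prod_XsubC _ _ _)) mulr1.
by apply: (scalerI c0); rewrite -ps -[in LHS]lc -pt.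
Qed.

(** * Roots of unity *)

(** Substitute [u] into the factorization of ['X^n - 1] over the powers of [w^-1] and absorb
    [w ^+ i] into the [i]-th factor. *)
Lemma prod_primitive_root (F : fieldType) (n : nat) (w : F) :
  n.-primitive_root w -> exists2 c : F, c != 0 &
  forall u : {poly F}, \prod_(0 <= i < n) (w ^+ i *: u - 1) = c *: (u ^+ n - 1).
Proof.
move=> pw; have n0 := prim_order_gt0 pw.
have w0 : w != 0.
  by apply/eqP => w0; have := prim_expr_order pw;
     rewrite w0 expr0n gtn_eqF // => /eqP; rewrite eq_sym oner_eq0.
have pw' : n.-primitive_root w^-1.
  have -> : w^-1 = w ^+ n.-1.
    by apply: (mulfI w0); rewrite divff // -exprS prednK // (prim_expr_order pw).
  rewrite (prim_root_exp_coprime _ pw) -[X in coprime _ X](prednK n0).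
  exact: coprimenS.
exists (\prod_(0 <= i < n) w ^+ i) => [|u].
  by rewrite prodf_seq_neq0; apply/allP => i _; rewrite expf_neq0.
have := congr1 (comp_poly u) (factor_Xn_sub_1 pw').
rewrite rmorph_prod rmorphB rmorphXn /= comp_polyX comp_polyC => <-.
rewrite -scaler_prod; apply: eq_bigr => i _.
rewrite rmorphB /= comp_polyX comp_polyC scalerBr -alg_polyC scalerA exprVn.
by rewrite divff ?expf_neq0 // scale1r.
Qed.

(** As [n] is nonzero in [F], ['X^n - 1] is separable; its [n] distinct roots include a primitive
    one. *)
Lemma exists_primitive_root (F : closedFieldType) (n : nat) :
  n%:R != 0 :> F -> exists w : F, n.-primitive_root w.
Proof.
move=> n0; have n_gt0 : (0 < n)%N by case: n n0 => //; rewrite eqxx.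
have [s] := closed_field_poly_normal ('X^n - 1 : {poly F}).
rewrite lead_coefXnsubC // scale1r => Es.
suff /hasP[w _ pw] : has n.-primitive_root s by exists w.
apply: has_prim_root => //.
- apply/allP => x xs; rewrite unity_rootE -subr_eq0.
  have : root ('X^n - 1) x by rewrite Es root_prod_XsubC.
  by rewrite /root !hornerE.
- by rewrite -separable_prod_XsubC -Es separable_Xn_sub_1.
- by rewrite -ltnS -(size_prod_XsubC _ id) -Es size_Xn_sub_1.
Qed.

(** * Polynomials as rational maps *)

Lemma homog_comp1 (F : closedFieldType) (d : nat) (a b : {poly F}) :
  homog_comp d 1 a b = b ^+ d.
Proof.
rewrite /homog_comp big_ord_recl coefC eqxx scale1r expr0 mul1r subn0.
by rewrite big1 ?addr0 // => i _; rewrite coefC /= scale0r.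
Qed.

Lemma homog_compX (F : closedFieldType) (a b : {poly F}) :
  homog_comp 1 'X a b = a.
Proof.
rewrite /homog_comp !big_ord_recl big_ord0 !coefX /= scale0r scale1r.
by rewrite expr1 expr0 mulr1 add0r addr0.
Qed.

Lemma homog_comp_poly (F : closedFieldType) (d : nat) (p a : {poly F}) :
  (size p <= d.+1)%N -> homog_comp d p a 1 = p \Po a.
Proof.
move=> sp; rewrite /homog_comp comp_polyE (big_ord_widen _ (fun i => p`_i *: a ^+ i) sp).
rewrite [RHS]big_mkcond; apply: eq_bigr => i _.
rewrite expr1n mulr1; case: ltnP => // le; by rewrite nth_default ?scale0r.
Qed.

Lemma rdeg_rpoly (F : closedFieldType) (p : {poly F}) :
  rdeg (rpoly p) = (size p).-1.
Proof.
rewrite /rdeg /= size_poly1 /maxn; case: ltnP => //.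
by case: (size p) => [|[]].
Qed.

Lemma rden_riter_rpoly (F : closedFieldType) (n : nat) (p : {poly F}) :
  rden (riter n (rpoly p)) = 1.
Proof. by elim: n => //= n IH; rewrite homog_comp1 IH expr1n. Qed.

Lemma rnum_riter_rpoly (F : closedFieldType) (n : nat) (p : {poly F}) :
  rnum (riter n.+1 (rpoly p)) = p \Po rnum (riter n (rpoly p)).
Proof.
rewrite /= rden_riter_rpoly homog_comp_poly // rdeg_rpoly.
exact: leqSpred.
Qed.

(** The last 0 belongs to infinity: in the chart there the map is ['X^d / a] with [d >= 2] and [a]
    the reversed polynomial, nonzero at 0, so 0 is a simple fixed point with zero derivative. *)
Lemma multipliers_poly (F : closedFieldType) (f : ratmap F) :
  rden f = 1 -> (2 < size (rnum f))%N ->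
  multipliers f
    = [seq (rnum f)^`().[x] | x <- proots (rnum f - 'X)] ++ [:: 0].
Proof.
case: f => p q cpq /= q1 sp; rewrite {q}q1 in cpq *.
set f := Ratmap cpq.
have df : rdeg f = (size p).-1 by rewrite -(rdeg_rpoly F p).
set a := homog_comp (size p).-1 p 1 'X.
have num : rnum (rchart f) = 'X^((size p).-1).
  by rewrite /= df /rdeg /= size_poly1 size_polyX !homog_comp1.
have den : rden (rchart f) = a.
  by rewrite /= df /rdeg /= size_poly1 size_polyX !homog_compX.
have a0 : a.[0] != 0.
  rewrite /a homog_comp_pole ?hornerX // hornerC expr1n mulr1.
  by rewrite -/(lead_coef p) lead_coef_eq0 -size_poly_gt0 (leq_ltn_trans _ sp).
have [m sm] : exists m, (size p).-1 = m.+2.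
  by case: (size p) sp => [|[|[|m]]] // _; exists m.
rewrite /multipliers /fixed_points map_cat -map_comp; congr (_ ++ _).
  rewrite /fixpoly /= mulr1; apply: eq_map => x /=.
  by rewrite /rderiv /= derivC !hornerC mulr0 subr0 expr1n divr1 mulr1.
have -> : mup 0 (fixpoly (rchart f)) = 1%N.
  rewrite /fixpoly num den sm exprS -mulrBr mupMl.
    by have := mup_XsubCX 1 (0 : F) 0; rewrite subr0 expr1 eqxx.
  by rewrite /root !hornerE expr0n /= sub0r oppr_eq0.
rewrite [map _ _]/= /rderiv num den sm derivXn hornerMn !hornerXn !expr0n.
by rewrite mul0rn !mul0r subr0 mul0r.
Qed.

(** * Fixed points under the semiconjugacy *)

(** Dividing by a root [x], nonzero by assumption, turns each factor into the form
    [w ^+ i *: u - 1]; the product over [i] is then a constant times ['X^k - x ^+ k]. *)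
Lemma prod_comp_root (F : closedFieldType) (k : nat) (w c : F) (s : seq F) :
  k.-primitive_root w -> c != 0 -> 0 \notin s ->
  exists2 e : F, e != 0 &
  \prod_(0 <= i < k) ((c *: \prod_(x <- s) ('X - x%:P)) \Po (w ^+ i *: 'X))
    = e *: (\prod_(x <- s) ('X - (x ^+ k)%:P) \Po 'X^k).
Proof.
move=> pw c0 s0; have [e e0 Ee] := prod_primitive_root _ _ _ pw.
exists (c ^+ k * \prod_(x <- s) e).
  by rewrite mulf_neq0 ?expf_neq0 // prodf_seq_neq0; apply/allP => x _; exact: e0.
under eq_bigr do rewrite comp_polyZ rmorph_prod /=.
rewrite scaler_prod prodr_const_nat subn0 exchange_big /= -scalerA; congr (_ *: _).
rewrite rmorph_prod -scaler_prod; apply: eq_big_seq => x xs /=.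
have x0 : x != 0 by apply: contraNneq s0 => <-.
have E i : ('X - x%:P) \Po (w ^+ i *: 'X) = x *: (w ^+ i *: (x^-1 *: 'X) - 1).
  rewrite comp_polyB comp_polyX comp_polyC scalerBr alg_polyC; congr (_ - _).
  by rewrite !scalerA mulrAC divff // mul1r.
under eq_bigr do rewrite E.
rewrite scaler_prod prodr_const_nat subn0 Ee comp_polyB comp_polyX comp_polyC.
rewrite exprZn exprVn scalerA mulrC -scalerA; congr (_ *: _).
by rewrite scalerBr scalerA divff ?expf_neq0 // scale1r -polyC1 -mul_polyC -polyCM mulr1.
Qed.

Lemma proots_powers (F : closedFieldType) (k s : nat) (A : {poly F}) :
  k%:R != 0 :> F -> (0 < s)%N -> coprime s k ->
  perm_eq (proots ('X * ('X^s * A ^+ k - 1)))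
    [seq x ^+ k | x <- proots ('X * ('X^s * (A \Po 'X^k) - 1))].
Proof.
move=> k0 s0 sk; have k_gt0 : (0 < k)%N by case: k k0 {sk} => //; rewrite eqxx.
have [w pw] := exists_primitive_root _ _ k0.
set f := 'X^s * (A \Po 'X^k) - 1; set g := 'X^s * A ^+ k - 1.
have f0 : f.[0] = -1 by rewrite !hornerE expr0n gtn_eqF // mul0r sub0r.
have lf0 : lead_coef f != 0.
  rewrite lead_coef_eq0; apply/eqP => f_0; move/eqP: f0.
  by rewrite f_0 horner0 eq_sym oppr_eq0 oner_eq0.
have [t ft] := closed_field_poly_normal f.
have t0 : 0 \notin t.
  have : ~~ root f 0 by rewrite /root f0 oppr_eq0 oner_eq0.
  by rewrite ft rootZ // root_prod_XsubC.
have Xprod (c : F) (r : seq F) :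
    'X * (c *: \prod_(x <- r) ('X - x%:P)) = c *: \prod_(x <- 0 :: r) ('X - x%:P).
  by rewrite big_cons subr0 scalerAr.
have ft' : perm_eq (proots ('X * f)) (0 :: t).
  by apply: (proots_prod _ _ _ _ lf0); rewrite -Xprod -ft.
have [e e0 Ee] := prod_comp_root _ _ _ _ _ pw lf0 t0.
(* Here the coprimality of [s] and [k] enters. *)
have pws : k.-primitive_root (w ^+ s) by rewrite (prim_root_exp_coprime _ pw).
have [c c0 Ec] := prod_primitive_root _ _ _ pws.
have gE : c *: (g \Po 'X^k) = e *: (\prod_(x <- t) ('X - (x ^+ k)%:P) \Po 'X^k).
  (* Rotating the variable by [w ^+ i] multiplies [u = 'X^s * (A \Po 'X^k)] by [(w ^+ s) ^+ i], and
     [u ^+ k] is ['X^s * A ^+ k] taken at ['X^k]. *)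
  rewrite -Ee -ft comp_polyB !rmorphM !rmorphXn /= comp_polyX comp_polyC polyC1.
  rewrite -exprM mulnC exprM -exprMn -Ec; apply: eq_bigr => i _.
  rewrite comp_polyB rmorphM /= -comp_polyA !rmorphXn /= comp_polyX comp_polyC.
  have wk : (w ^+ i) ^+ k = 1 by rewrite -exprM mulnC exprM (prim_expr_order pw) expr1n.
  by rewrite !exprZn wk scale1r -scalerAl -!exprM mulnC.
have {}gE : g = (c^-1 * e) *: \prod_(x <- [seq x ^+ k | x <- t]) ('X - x%:P).
  (* Composition with ['X^k] is injective, so it cancels. *)
  apply/eqP; rewrite -subr_eq0 -(@comp_poly_eq0 _ _ 'X^k) ?size_polyXn //.
  rewrite comp_polyB comp_polyZ big_map -scalerA -gE scalerA mulVf //.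
  by rewrite scale1r subrr.
have {}gE : perm_eq (proots ('X * g)) (0 :: [seq x ^+ k | x <- t]).
  apply: (@proots_prod _ _ (c^-1 * e)); first by rewrite mulf_neq0 ?invr_eq0.
  by rewrite -Xprod -gE.
rewrite (perm_trans gE) // perm_sym (perm_trans (perm_map _ ft')) //=.
by rewrite expr0n gtn_eqF.
Qed.

(** * Iterates and their multipliers *)

(** Differentiate at [x]: since [p.[x] = x], both sides carry the nonzero factor [k x^(k-1)]. *)
Lemma deriv_semiconj (F : fieldType) (k : nat) (p q : {poly F}) (x : F) :
  k%:R != 0 :> F -> p ^+ k = q \Po 'X^k -> x != 0 -> p.[x] = x ->
  p^`().[x] = q^`().[x ^+ k].
Proof.
move=> k0 pq x0 px; have := congr1 (fun u => u^`().[x]) pq.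
rewrite deriv_exp deriv_comp derivXn -mulrnAr !hornerM !hornerMn horner_comp.
rewrite horner_exp !hornerXn px => /mulIf; apply.
by rewrite -mulr_natr mulf_neq0 ?expf_neq0.
Qed.

Lemma iter_skew_power (F : closedFieldType) (r k n : nat) (R : {poly F}) :
  (0 < r)%N -> (0 < k)%N -> R != 0 -> exists A : {poly F}, [/\ A != 0,
    rnum (riter n (rpoly ('X^r * (R \Po 'X^k)))) = 'X^(r ^ n) * (A \Po 'X^k) &
    rnum (riter n (rpoly ('X^r * R ^+ k))) = 'X^(r ^ n) * A ^+ k].
Proof.
move=> r0 k0 R0; elim: n => [|n [A [A0 EP EQ]]].
  by exists 1; rewrite oner_eq0 comp_polyC expr1n !mulr1.
(* One cofactor serves both: with [m = r^n], [R(z^k)] at [z^m A(z^k)] is [R(z^m A^k)] taken at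
   [z^k]. *)
exists (A ^+ r * (R \Po ('X^(r ^ n) * A ^+ k))); split.
- rewrite mulf_neq0 ?expf_neq0 // comp_poly_eq0 //.
  rewrite size_monicM ?monicXn ?expf_neq0 // size_polyXn addSn /=.
  by apply: (@leq_add 1 1); rewrite ?expn_gt0 ?r0 // size_poly_gt0 expf_neq0.
- rewrite rnum_riter_rpoly EP !rmorphM /= !rmorphXn /= -!comp_polyA comp_polyX.
  rewrite !rmorphM /= !rmorphXn /= comp_polyX.
  rewrite !exprMn -!exprM -expnSr mulrA comp_polyX.
  by rewrite -exprM [(k * _)%N]mulnC.
- rewrite rnum_riter_rpoly EQ !rmorphM /= !rmorphXn /= comp_polyX.
  by rewrite !exprMn -!exprM -expnSr -mulrA [(k * r)%N]mulnC.
Qed.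

Lemma size_skew_power (F : fieldType) (s k : nat) (A : {poly F}) :
  (0 < k)%N -> A != 0 -> size ('X^s * (A \Po 'X^k)) = size ('X^s * A ^+ k).
Proof.
move=> k0 A0; have Ak0 : A \Po 'X^k != 0 by rewrite comp_poly_eq0 // size_polyXn.
rewrite !size_monicM ?monicXn ?expf_neq0 //.
suff -> : size (A \Po 'X^k) = size (A ^+ k) by [].
rewrite -[LHS]prednK ?size_poly_gt0 // -[RHS]prednK ?size_poly_gt0 ?expf_neq0 //.
by rewrite size_comp_poly size_polyXn size_exp.
Qed.

Lemma horner_proots (F : closedFieldType) (p : {poly F}) (x : F) :
  x \in proots p -> p.[x] = 0.
Proof.
rewrite /proots; case: closed_field_poly_normal => s /= -> xs.
by rewrite hornerZ (rootP _) ?mulr0 // root_prod_XsubC.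
Qed.

Lemma multipliers_skew_power (F : closedFieldType) (r k n : nat) (R : {poly F}) :
  (1 < r)%N -> k%:R != 0 :> F -> R != 0 -> coprime (r ^ n.+1 - 1) k ->
  perm_eq (multipliers (riter n.+1 (rpoly ('X^r * (R \Po 'X^k)))))
          (multipliers (riter n.+1 (rpoly ('X^r * R ^+ k)))).
Proof.
move=> r1 k0 R0 rk; have k_gt0 : (0 < k)%N by case: k k0 {rk} => //; rewrite eqxx.
have [A [A0 EP EQ]] := iter_skew_power F r k n.+1 R (ltnW r1) k_gt0 R0.
have rn1 : (1 < r ^ n.+1)%N by rewrite -(exp1n n.+1) ltn_exp2r.
move: EP EQ rn1 rk; set m := (r ^ _)%N; set P := riter _ _; set Q := riter _ _.
move=> EP EQ m1 mk.
have [dP dQ] : rden P = 1 /\ rden Q = 1 by rewrite !rden_riter_rpoly.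
clearbody P Q.
have sP : size (rnum P) = size (rnum Q) by rewrite EP EQ size_skew_power.
have sQ : (2 < size (rnum Q))%N.
  rewrite EQ size_monicM ?monicXn ?expf_neq0 // size_polyXn addSn /=.
  by apply: (@leq_add 2 1) => //; rewrite size_poly_gt0 expf_neq0.
(* The zeros from infinity cancel. *)
rewrite !multipliers_poly ?sP // perm_cat2r.
have mE : 'X^m = 'X * 'X^(m - 1) :> {poly F} by rewrite -exprS subn1 prednK // ltnW.
have fE B : 'X^m * B - 'X = 'X * ('X^(m - 1) * B - 1) :> {poly F}.
  by rewrite mulrBr mulr1 mulrA -mE.
have := proots_powers _ k (m - 1) A k0; rewrite subn_gt0 => /(_ m1 mk).
rewrite -!fE -EP -EQ => pPQ.
rewrite perm_sym (perm_trans (perm_map _ pPQ)) // -map_comp.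
have deriv0 B : ('X^m * B : {poly F})^`().[0] = 0.
  rewrite derivM derivXn hornerD !hornerM hornerMn !hornerXn !expr0n.
  by rewrite -subn1 subn_eq0 leqNgt m1 [m == _]gtn_eqF ?(ltnW m1) // mul0rn !mul0r addr0.
rewrite (_ : map (_ \o _) _ = [seq (rnum P)^`().[x] | x <- proots (rnum P - 'X)]) //.
apply/eq_in_map => x /horner_proots/eqP; rewrite /= hornerD hornerN hornerX subr_eq0.
(* At 0 both derivatives vanish because [m >= 2]; elsewhere the chain rule applies. *)
move=> /eqP Px; have [->|x0] := eqVneq x 0.
  by rewrite expr0n gtn_eqF // EP EQ !deriv0.
apply/esym/deriv_semiconj => //.
by rewrite EP EQ !rmorphM /= !rmorphXn /= comp_polyX exprMn -!exprM mulnC.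
Qed.

(** * The arithmetic progression of iterates *)

Lemma S_mkseq (F : closedFieldType) (n : nat) (f : ratmap F) :
  S_ n f = mkseq (fun i => Defs.esym (multipliers (riter n f)) i.+1)
             (rdeg f ^ n).+1 :> seq F.
Proof. by rewrite /mkseq -val_enum_ord -map_comp. Qed.

Lemma coprime_expn_totient (r k a b : nat) : (0 < r)%N ->
  coprime (r * (r ^ a - 1)) k -> coprime (r ^ (a + b * totient k) - 1) k.
Proof.
move=> r0; rewrite coprimeMl => /andP[rk]; rewrite -![coprime (_ - 1) _]coprime_modl.
(* Coprimality to [k] depends only on the residue, and [r ^ totient k] is 1 modulo [k]. *)
suff /eqP -> : r ^ (a + b * totient k) - 1 == r ^ a - 1 %[mod k] by [].
rewrite -(eqn_modDr 1) !subnK ?expn_gt0 ?r0 // expnD mulnC [(b * _)%N]mulnC expnM.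
by rewrite -modnMml -modnXm (Euler_exp_totient rk) modnXm exp1n modnMml mul1n.
Qed.

Theorem theorem4p6 (K : realType) (r k : nat) (R : {poly K[i]}) :
  (2 <= r)%N -> (0 < k)%N -> R != 0 ->
  (exists M : nat, (0 < M)%N /\ coprime (r * (r ^ M - 1)) k) ->
  let P := rpoly ('X^r * (R \Po 'X^k)) in
  let Q := rpoly ('X^r * R ^+ k) in
  exists d c1 : nat, [/\ (0 < c1)%N, (c1 < d)%N &
    forall N : nat,
      S_ (c1 + N * d) P = S_ (c1 + N * d) Q :> seq K[i]].
Proof.
move=> r2 k0 R0 [M [M0 cop]] P Q.
(* A multiple of [totient k] preserves the residue of [r ^ n]; the factor [M.+1] makes it exceed
   [M]. *)
exists (M.+1 * totient k)%N, M; split => // [|N].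
  by apply: leq_pmulr; rewrite totient_gt0.
have eP : rdeg P = rdeg Q by rewrite !rdeg_rpoly size_skew_power.
have := coprime_expn_totient r k M (N * M.+1) (ltnW r2) cop.
(* The exponent is positive since [M] is, which excludes the identity iterate. *)
rewrite mulnA; case En : (M + _)%N => [|n] copn.
  by rewrite -[M]prednK in En.
rewrite !S_mkseq eP; apply: eq_mkseq => i; apply: esym_perm.
apply: multipliers_skew_power => //.
by rewrite pnatr_eq0 -lt0n.
Qed.
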